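(* Let $G=(V,E,\sigma)$ be a finite undirected graph with positive edge weights $\sigma\in\mathbb{R}^E_{>0}$, let $\Gamma_{\text{ec}}$ be its family of edge covers and $\Gamma_{\text{fec}}$ its family of fractional edge covers. Then for all $p\in[1,\infty)$, \[ \left(\tfrac{3}{4}\right)^p \mathrm{Mod}_{p,\sigma}(\Gamma_{\text{fec}}) \le \mathrm{Mod}_{p,\sigma}(\Gamma_{\text{ec}}) \le \mathrm{Mod}_{p,\sigma}(\Gamma_{\text{fec}}). \] If $G$ is bipartite, then $\mathrm{Mod}_{p,\sigma}(\Gamma_{\text{ec}}) = \mathrm{Mod}_{p,\sigma}(\Gamma_{\text{fec}})$.
   Context: A family of objects $\Gamma$ on $G$ is a set of nonnegative vectors $\gamma\in\mathbb{R}^E_{\ge 0}$ (the ''usage'' of each edge by the object). An edge cover is a set $C\subseteq E$ with $|C\cap\delta(v)|\ge 1$ for every $v\in V$, where $\delta(v)$ is the set of edges incident to $v$; it is identified with its indicator vector $\mathbb{1}_C\in\mathbb{R}^E$. A fractional edge cover is a vector $\gamma\in\mathbb{R}^E_{\ge0}$ with $\sum_{e\in\delta(v)}\gamma(e)\ge 1$ for all $v\in V$. For a density $\rho\in\mathbb{R}^E_{\ge 0}$, the $\rho$-length of $\gamma$ is $\ell_\rho(\gamma)=\sum_{e}\gamma(e)\rho(e)$; $\rho$ is admissible for $\Gamma$ if $\ell_\rho(\gamma)\ge 1$ for all $\gamma\in\Gamma$, and $\mathrm{Adm}(\Gamma)$ is the set of admissible densities. For $1\le p<\infty$, $\mathcal{E}_{p,\sigma}(\rho)=\sum_{e\in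 E}\sigma(e)\rho(e)^p$ and $\mathrm{Mod}_{p,\sigma}(\Gamma)=\inf_{\rho\in\mathrm{Adm}(\Gamma)}\mathcal{E}_{p,\sigma}(\rho)$. *)

(* Defs.v *)
From mathcomp Require Import all_boot all_order all_algebra.
From mathcomp Require Import all_classical all_reals all_analysis.

Set Implicit Arguments.
Unset Strict Implicit.
Unset Printing Implicit Defensive.

Import Order.TTheory GRing.Theory Num.Theory.

Local Open Scope classical_set_scope.
Local Open Scope ring_scope.

(* Finite undirected graphs; parallel edges are allowed, and an edge with a
   single endpoint is a loop (so that a loop at v occurs once in delta(v)). *)
Record ugraph := UGraph {
  vertex : finType;
  edge : finType;
  ends : edge -> {set vertex};
  card_ends : forall e, (0 < #|ends e| <= 2)%N }.

Definition delta (G : ugraph) (v : vertex G) : {set edge G} :=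
  finset (fun e => v \in ends e).

(* The two sides are A and its complement. *)
Definition bipartite (G : ugraph) : Prop :=
  exists A : {set vertex G}, forall e : edge G,
    #|ends e :&: A| = 1%N /\ #|ends e :\: A| = 1%N.

Definition edge_cover (G : ugraph) (C : {set edge G}) : Prop :=
  forall v : vertex G, (1 <= #|C :&: delta v|)%N.

Section Modulus.
Variable R : realType.

Definition indicator (E : finType) (C : {set E}) : E -> R :=
  fun e => (e \in C)%:R.

Definition edge_covers (G : ugraph) : set (edge G -> R) :=
  [set gamma | exists2 C : {set edge G}, edge_cover C & gamma = indicator C].

Definition fractional_edge_covers (G : ugraph) : set (edge G -> R) :=
  [set gamma | (forall e, 0 <= gamma e) /\
               (forall v : vertex G, 1 <= \sum_(e in delta v) gamma e)].

Variable E : finType.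
Implicit Types (rho gamma sigma : E -> R) (Gamma : set (E -> R)).

Definition rho_length rho gamma : R := \sum_(e : E) gamma e * rho e.

Definition Adm Gamma : set (E -> R) :=
  [set rho | (forall e, 0 <= rho e) /\
             (forall gamma, Gamma gamma -> 1 <= rho_length rho gamma)].

Definition energy (p : R) sigma rho : R := \sum_(e : E) sigma e * rho e `^ p.

(* Extended-real valued, with value +oo when no density is admissible (for
   instance, when the zero vector belongs to Gamma). *)
Definition Mod (p : R) sigma Gamma : \bar R :=
  ereal_inf ((fun rho => (energy p sigma rho)%:E) @` Adm Gamma).

End Modulus.

Arguments edge_covers R G : clear implicits.
Arguments fractional_edge_covers R G : clear implicits.

(* Main.v *)
Require Import Defs.
From mathcomp Require Import all_boot all_order all_algebra.
From mathcomp Require Import all_classical all_reals all_analysis.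
From mathcomp Require Import zify ring lra.

(** Moving a fractional edge cover inside the polytope
    [0 <= gamma <= 1, gamma(delta v) >= 1], without increasing its rho-length,
    until no direction preserves all tight constraints, reaches a vertex of
    the polytope.  Let [F] be its fractional edges and [T] the tight vertices
    they meet.  Linear algebra gives [#|F| <= #|T|], whereas each vertex of [T]
    lies on at least two edges of [F]; hence [F] is 2-regular on [T], and it
    follows that [gamma = 1/2] on [F].  In the bipartite case [F] is empty and
    the vertex is an edge cover.  In general a 2-regular graph is properly
    3-edge-colourable, and dropping from [F] its heaviest colour class gives an
    edge cover of length at most [2/3] of that of [F], that is, [4/3] of what
    the half-integral vertex pays on [F].  So [4/3 rho] is admissible for
    fractional edge covers whenever [rho] is admissible for edge covers. *)

Import Order.TTheory GRing.Theory Num.Theory.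
Local Open Scope ring_scope.

(** * Tools: greedy colouring, kernels and the ratio test *)

(** The vertices are coloured one at a time: the neighbours of a new vertex use at most [k] colours,
    so one of the [k.+1] is free. *)
Lemma greedy_coloring {T : finType} {r : rel T} {k : nat} :
  symmetric r -> irreflexive r ->
  (forall x, (#|finset (r x)| <= k)%N) ->
  exists c : T -> 'I_k.+1, forall x y, r x y -> c x != c y.
Proof.
move=> rC rI deg_r.
suff H n (S : {set T}) : #|S| = n -> exists c : T -> 'I_k.+1,
    forall x y, x \in S -> y \in S -> r x y -> c x != c y.
  have [c Hc] := H _ [set: T]%SET erefl.
  by exists c => x y; apply: Hc; rewrite inE.
elim: n S => [|n IH] S cardS.
  move/eqP: cardS; rewrite cards_eq0 => /eqP ->.
  by exists (fun=> ord0) => x y; rewrite inE.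
have /card_gt0P [z zS] : (0 < #|S|)%N by rewrite cardS.
have [|c Hc] := IH (S :\ z)%SET.
  by move: cardS; rewrite (cardsD1 z) zS => -[].
have [a aP] : exists a, a \notin (c @: finset (r z))%SET.
  apply/existsP; rewrite -negb_forall; apply/negP => /forallP allc.
  have := leq_trans (leq_imset_card c (mem (finset (r z)))) (deg_r z).
  suff -> : (c @: finset (r z) = [set: 'I_k.+1])%SET by rewrite cardsT card_ord ltnn.
  by apply/setP => i; rewrite inE; exact: allc.
exists (fun x => if x == z then a else c x) => x y xS yS rxy.
have colz w : r z w -> a != c w.
  by move=> rzw; apply: contra aP => /eqP ->; apply: imset_f; rewrite inE.
case: (eqVneq x z) => [xz|xz]; case: (eqVneq y z) => [yz|yz].
- by move: rxy; rewrite xz yz rI.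
- by apply: colz; rewrite -xz.
- by rewrite eq_sym; apply: colz; rewrite rC -yz.
- by apply: Hc; rewrite // !inE ?xz ?yz.
Qed.

(** A homogeneous system with fewer equations than unknowns: the [#|F|] by [#|T|] matrix has a
    nonzero left kernel. *)
Lemma nonzero_supported_solution {R : fieldType} {E V : finType}
    (F : {set E}) (T : {set V}) (m : E -> V -> R) : (#|T| < #|F|)%N ->
  exists d : E -> R, [/\ forall e, e \notin F -> d e = 0,
    exists e, d e != 0 & forall v, v \in T -> \sum_e d e * m e v = 0].
Proof.
move=> ltTF.
pose M := \matrix_(i < #|F|, j < #|T|) m (enum_val i) (enum_val j).
have : kermx M != 0.
  rewrite -mxrank_eq0 mxrank_ker -lt0n subn_gt0.
  by apply: leq_ltn_trans ltTF; exact: rank_leq_col.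
case/rowV0Pn => u /sub_kermxP uM u0.
have [i0 ui0] : exists i, u 0 i != 0.
  apply/existsP; rewrite -negb_forall; apply: contra u0 => /forallP u0.
  by apply/eqP/rowP => i; rewrite mxE; apply/eqP; have := u0 i; rewrite ?negbK.
(* Extension by zero off [F]; [insub] supplies the membership proof that [enum_rank_in] needs. *)
pose d e := if insub e is Some x
  then u 0 (enum_rank_in (valP (x : {e | e \in F})) e) else 0.
have dval i : d (enum_val i) = u 0 i.
  rewrite /d; case: insubP => [x xF Ex|]; last by rewrite enum_valP.
  by rewrite enum_valK_in.
exists d; split.
- by move=> e eF; rewrite /d insubN.
- by exists (enum_val i0); rewrite dval.
move=> v vT; have := congr1 (fun N : 'rV_ _ => N 0 (enum_rank_in vT v)) uM.
rewrite !mxE => E0; rewrite -[RHS]E0 (bigID (mem F)) /= [X in _ + X]big1 ?addr0.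
  rewrite big_enum_val; apply: eq_bigr => i _.
  by rewrite mxE dval enum_rankK_in.
by move=> e eF; rewrite /d insubN ?mul0r.
Qed.

(** Ratio test: [t] is the least [a i / - b i] over the indices with [b i < 0], and the second
    hypothesis makes it positive. *)
Lemma first_boundary_hit {R : realFieldType} {I : finType} {a b : I -> R} :
  (forall i, 0 <= a i) -> (forall i, a i = 0 -> b i = 0) ->
  (exists i, b i < 0) ->
  exists t, [/\ 0 < t, forall i, 0 <= a i + t * b i &
    exists2 i, a i != 0 & a i + t * b i = 0].
Proof.
move=> a0 ab [i0 bi0].
case: (@Order.TotalTheory.arg_minP _ _ _ i0 (fun i => b i < 0)
  (fun i => a i / - b i) bi0) => i bi mini.
have ai : a i != 0 by apply/eqP => /ab bE; rewrite bE ltxx in bi.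
have aip : 0 < a i by rewrite lt_neqAle eq_sym ai a0.
exists (a i / - b i); split.
- by rewrite divr_gt0 // oppr_gt0.
- move=> j; case: (ltP (b j) 0) => bj.
    have := mini j bj; rewrite ler_pdivlMr ?oppr_gt0 // mulrN.
    by rewrite lerNl -subr_ge0 opprK addrC.
  by rewrite addr_ge0 // mulr_ge0 // divr_ge0 ?a0 // oppr_ge0 ltW.
exists i => //; rewrite invrN mulrN mulNr divfK ?subrr //.
by rewrite lt_eqF.
Qed.

(** * The polytope of capped fractional covers *)

Section EdgeCoverPolytope.
Variables (R : realType) (G : ugraph).
Implicit Types (gamma d rho : edge G -> R) (v : vertex G) (e : edge G).

Let constraint := (edge G + edge G + vertex G)%type.

Definition load gamma v : R := \sum_(e in delta v) gamma e.

Definition slack gamma (i : constraint) : R :=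
  match i with
  | inl (inl e) => gamma e
  | inl (inr e) => 1 - gamma e
  | inr v => load gamma v - 1
  end.

Definition rate d (i : constraint) : R :=
  match i with inl (inl e) => d e | inl (inr e) => - d e | inr v => load d v end.

(** A vertex of the polytope in algebraic form: the tight constraints have full column rank. *)
Definition extreme gamma : Prop := forall d,
  (forall i, slack gamma i = 0 -> rate d i = 0) -> forall e, d e = 0.

Lemma in_delta e v : (e \in delta v) = (v \in ends e).
Proof. by rewrite inE. Qed.

Lemma slack_move gamma d t i :
  slack (fun e => gamma e + t * d e) i = slack gamma i + t * rate d i.
Proof.
case: i => [[e|e]|v] /=; [by []|by ring|].
by rewrite /load big_split /= -mulr_sumr addrAC.
Qed.

(** Induction on the number of constraints that are not tight: a move along [d] keeps the tight ones
    tight and stops when another becomes so. *)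
Lemma extreme_reduction rho gamma : (forall i, 0 <= slack gamma i) ->
  exists gamma', [/\ forall i, 0 <= slack gamma' i, extreme gamma' &
    rho_length rho gamma' <= rho_length rho gamma].
Proof.
have [n] := ubnP #|finset (fun i => slack gamma i != 0)|.
elim: n gamma => // n IH gamma ltn slack_ge0.
have [ext|] := pselect (extreme gamma); first by exists gamma.
move=> /existsNP[d /not_implyP[dtight /existsNP[e0 /eqP de0]]].
(* [- d] respects the same tight constraints, so the sign can be chosen so that the length does not
   increase. *)
wlog dle : d dtight de0 / rho_length rho d <= 0.
  move=> H; case: (lerP (rho_length rho d) 0) => [|dgt]; first exact: H.
  apply: (H (fun e => - d e)); last 2 first.
  - by rewrite oppr_eq0.
  - rewrite /rho_length; under eq_bigr do rewrite mulNr.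
    by rewrite sumrN oppr_le0 ltW.
  move=> i /dtight; case: i => [[e|e]|v] /=; rewrite ?opprK => E.
  - by rewrite E oppr0.
  - by rewrite -[d e]opprK E oppr0.
  - by rewrite /load sumrN; rewrite /load in E; rewrite E oppr0.
have [t [tgt0 tge0 [i ai ti]]] : exists t, [/\ 0 < t,
    forall i, 0 <= slack gamma i + t * rate d i &
    exists2 i, slack gamma i != 0 & slack gamma i + t * rate d i = 0].
  apply: first_boundary_hit => //.
  (* Whichever sign [d e0] has, one of the bounds 0 and 1 on [e0] stops the motion. *)
  case: (ltP (d e0) 0) => de; first by exists (inl (inl e0)).
  by exists (inl (inr e0)); rewrite /= oppr_lt0 lt_neqAle eq_sym de0.
have [||gamma' [g1 g2 g3]] := IH (fun e => gamma e + t * d e).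
- rewrite -ltnS; apply: leq_trans ltn; rewrite ltnS; apply: proper_card.
  apply/properP; split.
    apply/fintype.subsetP => j; rewrite !inE slack_move; apply: contra => /eqP E.
    by rewrite E (dtight _ E) mulr0 addr0.
  by exists i; rewrite !inE // slack_move ti eqxx.
- by move=> j; rewrite slack_move.
exists gamma'; split => //; apply: le_trans g3 _.
rewrite /rho_length; under eq_bigr do rewrite mulrDl -mulrA.
rewrite big_split /= -mulr_sumr gerDl.
exact: mulr_ge0_le0 (ltW tgt0) dle.
Qed.

(** * Structure of an extreme point *)

Section ExtremePoint.
Variables (gamma : edge G -> R).
Hypotheses (slack_ge0 : forall i, 0 <= slack gamma i) (gamma_ext : extreme gamma).

Let F := finset (fun e => (gamma e != 0) && (gamma e != 1)).
Let T := finset (fun v => (load gamma v == 1) && (delta v :&: F != finset.set0)%SET).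

Let gamma_ge0 e : 0 <= gamma e. Proof. exact: (slack_ge0 (inl (inl e))). Qed.
Let gamma_le1 e : gamma e <= 1.
Proof. by rewrite -subr_ge0; exact: (slack_ge0 (inl (inr e))). Qed.
Let load_ge1 v : 1 <= load gamma v.
Proof. by rewrite -subr_ge0; exact: (slack_ge0 (inr v)). Qed.

Let F_gt0 e : e \in F -> 0 < gamma e.
Proof. by rewrite inE lt_neqAle eq_sym gamma_ge0 andbT => /andP[]. Qed.
Let F_lt1 e : e \in F -> gamma e < 1.
Proof. by rewrite inE lt_neqAle gamma_le1 andbT => /andP[]. Qed.

(** No box constraint is tight on [F], and a tight vertex outside [T] meets no edge of [F]; so such
    a [d] preserves every tight constraint. *)
Lemma extreme_kernel d : (forall e, e \notin F -> d e = 0) ->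
  (forall v, v \in T -> load d v = 0) -> forall e, d e = 0.
Proof.
move=> dF dT; apply: gamma_ext => -[[e|e]|v] /= E.
- by apply: dF; rewrite inE E eqxx.
- by rewrite dF ?oppr0 // inE (_ : gamma e = 1) ?eqxx ?andbF //; lra.
have [vT|] := boolP (v \in T); first exact: dT.
rewrite inE -subr_eq0 E eqxx /= negbK => /eqP disj.
rewrite /load big1 // => e ev; apply: dF; apply/negP => eF.
by have := finset.in_set0 e; rewrite -disj inE ev eF.
Qed.

(** An edge of value 1 at [v], together with a fractional edge, which is positive, would push the
    load above 1. *)
Lemma tight_support v e : v \in T -> e \in delta v -> e \notin F -> gamma e = 0.
Proof.
rewrite inE => /andP[/eqP vt /finset.set0Pn[f]]; rewrite inE => /andP[fv fF] ev eF.
apply/eqP; apply: contraT => e0.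
have e1 : gamma e = 1.
  by apply/eqP; move: eF; rewrite inE e0 /= negbK.
have fe : f != e by apply: contra eF => /eqP <-.
move: vt; rewrite /load (bigD1 e) //= (bigD1 f) /=; last by rewrite fv.
have := F_gt0 _ fF.
have : 0 <= \sum_(i | (i \in delta v) && (i != e) && (i != f)) gamma i.
  exact: sumr_ge0.
by rewrite e1; lra.
Qed.

Lemma load_fractional v (d : edge G -> R) : (forall e, e \notin F -> d e = 0) ->
  load d v = \sum_(e in delta v :&: F) d e.
Proof.
move=> dF; rewrite /load (bigID (mem F)) /= [X in _ + X]big1 ?addr0.
  by apply: eq_bigl => e; rewrite finset.in_setI.
by move=> e /andP[_]; exact: dF.
Qed.

Lemma tight_fractional_sum v : v \in T -> \sum_(e in delta v :&: F) gamma e = 1.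
Proof.
move=> vT; move: (vT); rewrite inE => /andP[/eqP <- _].
rewrite /load [RHS](bigID (mem F)) /= [X in _ = _ + X]big1 ?addr0.
  by apply: eq_bigl => e; rewrite finset.in_setI.
by move=> e /andP[]; exact: tight_support.
Qed.

(** A lone fractional edge at [v] would have to carry the whole load 1. *)
Lemma tight_degree_ge2 v : v \in T -> (2 <= #|delta v :&: F|)%N.
Proof.
move=> vT; move: (vT); rewrite inE => /andP[_]; rewrite -card_gt0.
case E : #|_| => [|[|]] // _.
have /cards1P[e Ee] : #|(delta v :&: F)%SET| == 1%N by rewrite E.
have := tight_fractional_sum _ vT; rewrite Ee big_set1 => e1.
have /F_lt1 : e \in F by have := set11 e; rewrite -Ee inE => /andP[].
by rewrite e1 ltxx.
Qed.

Lemma sum_tight_degrees :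
  (\sum_(v in T) #|delta v :&: F| = \sum_(e in F) #|ends e :&: T|)%N.
Proof.
under eq_bigr do rewrite -sum1_card big_mkcond /=.
under [RHS]eq_bigr do rewrite -sum1_card big_mkcond /=.
rewrite exchange_big [RHS]big_mkcond /=; apply: eq_bigr => e _.
have [eF|eF] := boolP (e \in F); last first.
  by rewrite big1 // => v _; rewrite finset.in_setI (negPf eF) andbF.
rewrite big_mkcond; apply: eq_bigr => v _.
by rewrite !finset.in_setI eF andbT in_delta; case: (v \in T); case: (v \in ends e).
Qed.

(** Otherwise the load equations at [T] would have a nonzero solution supported on [F], against
    [extreme_kernel]. *)
Lemma card_fractional_le : (#|F| <= #|T|)%N.
Proof.
rewrite leqNgt; apply/negP.
case/(nonzero_supported_solution F T (fun e v => (e \in delta v)%:R : R)) =>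
  d [dF [e /eqP de] dT].
apply: de; apply: extreme_kernel => // v /dT <-.
by rewrite /load big_mkcond; apply: eq_bigr => f _; case: ifP; rewrite ?mulr1 ?mulr0.
Qed.

(** The number of incidences between [F] and [T] is at least [2 * #|T|] and at most [2 * #|F|],
    hence at most [2 * #|T|]; equality holds throughout, and so in each term. *)
Lemma fractional_2regular : [/\ #|F| = #|T|,
  forall v, v \in T -> #|delta v :&: F| = 2%N &
  forall e, e \in F -> #|ends e :&: T| = 2%N].
Proof.
have le1 : (\sum_(v in T) 2 <= \sum_(v in T) #|delta v :&: F|)%N.
  by apply: leq_sum => v; exact: tight_degree_ge2.
have le_e e : (#|ends e :&: T| <= 2)%N.
  have /andP[_] := card_ends e; apply: leq_trans.
  by rewrite subset_leq_card // finset.subsetIl.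
have le2 : (\sum_(e in F) #|ends e :&: T| <= \sum_(e in F) 2)%N.
  by apply: leq_sum => e _; exact: le_e.
have := card_fractional_le.
move: (le1) (le2); rewrite sum_tight_degrees !sum_nat_const => l1 l2 l3.
split; first by lia.
- move=> v vT; apply/eqP; rewrite eqn_leq tight_degree_ge2 // andbT leqNgt.
  apply/negP => lt; move: le2; rewrite -sum_tight_degrees (bigD1 v) //=.
  have : (\sum_(w in T | w != v) 2 <= \sum_(w in T | w != v) #|delta w :&: F|)%N.
    by apply: leq_sum => w /andP[wT _]; exact: tight_degree_ge2.
  have : (\sum_(w in T) 2 = 2 + \sum_(w in T | w != v) 2)%N by rewrite (bigD1 v).
  rewrite !sum_nat_const; lia.
- move=> e eF; apply/eqP; rewrite eqn_leq le_e /= leqNgt.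
  apply/negP => lt; move: le1; rewrite sum_tight_degrees (bigD1 e) //=.
  have : (\sum_(w in F | w != e) #|ends w :&: T| <= \sum_(w in F | w != e) 2)%N.
    by apply: leq_sum => w _; exact: le_e.
  have : (\sum_(w in F) 2 = 2 + \sum_(w in F | w != e) 2)%N by rewrite (bigD1 e).
  rewrite !sum_nat_const; lia.
Qed.

Lemma fractional_ends e v : e \in F -> v \in ends e -> v \in T.
Proof.
case: fractional_2regular => _ _ H eF; have /andP[_ c2] := card_ends e.
have /eqP <- : (ends e :&: T == ends e)%SET.
  by rewrite eqEcard finset.subsetIl H.
by rewrite inE => /andP[].
Qed.

(* [gamma - 1/2] on [F] has zero load on tight vertices. *)
Lemma fractional_half e : e \in F -> gamma e = 1 / 2.
Proof.
case: fractional_2regular => _ H _ eF.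
pose d e := if e \in F then gamma e - 1 / 2 else 0.
suff : d e = 0 by rewrite /d eF; lra.
have dF f : f \notin F -> d f = 0 by rewrite /d => /negPf ->.
apply: extreme_kernel => // v vT; rewrite load_fractional //.
transitivity (\sum_(f in delta v :&: F) (gamma f - 1 / 2)).
  by apply: eq_bigr => f; rewrite finset.in_setI /d => /andP[_ ->].
rewrite big_split /= tight_fractional_sum // sumr_const H // -mulr_natr; lra.
Qed.

(* The sum of the incidence rows of [T], signed by the two sides, vanishes on
   [F], so one tight constraint is redundant and [#|T| = #|F|] leaves a nonzero kernel. *)
Lemma bipartite_integral : bipartite G -> F = finset.set0.
Proof.
case=> A bipA; have [cFT _ H] := fractional_2regular.
apply/eqP; apply: contraT => /finset.set0Pn[e0 e0F].
have : (0 < #|T|)%N by rewrite -cFT; apply/card_gt0P; exists e0.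
case/card_gt0P => v0 v0T.
have : (#|T :\ v0| < #|F|)%N by rewrite cFT (cardsD1 v0 T) v0T.
case/(nonzero_supported_solution F _ (fun e v => (e \in delta v)%:R : R)) =>
  d [dF [e /eqP de] dT].
have loadE v : load d v = \sum_f d f * (f \in delta v)%:R.
  by rewrite /load big_mkcond; apply: eq_bigr => f _; case: ifP; rewrite ?mulr1 ?mulr0.
(* All ends of an edge of [F] lie in [T], so a side meeting every edge once counts [d f] exactly
   once. *)
have side (B : {set vertex G}) : (forall e, #|ends e :&: B| = 1%N) ->
    \sum_(v in T :&: B) load d v = \sum_f d f.
  move=> cB; under eq_bigr do rewrite loadE.
  rewrite exchange_big /=; apply: eq_bigr => f _; rewrite -mulr_sumr.
  have [fF|fF] := boolP (f \in F); last by rewrite dF // mul0r.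
  rewrite -natr_sum; suff -> : (\sum_(v in T :&: B) (f \in delta v) = 1)%N by rewrite mulr1.
  rewrite -(cB f) -sum1_card big_mkcond [RHS]big_mkcond /=.
  apply: eq_bigr => v _; rewrite !finset.in_setI in_delta.
  case vf : (v \in ends f) => /=; last by rewrite if_same.
  by rewrite (fractional_ends _ _ fF vf).
have sA := side A (fun e => (bipA e).1).
have sC : \sum_(v in T :&: ~: A) load d v = \sum_f d f.
  by apply: side => f; rewrite -finset.setDE (bipA f).2.
have loadT v : v \in T -> v != v0 -> load d v = 0.
  by move=> vT vv0; rewrite loadE; apply: dT; rewrite finset.in_setD1 vv0.
have load0 : load d v0 = 0.
  (* The side without [v0] has total load zero; the side totals agree, and on its own side [v0]
     contributes the only remaining term. *)
  have only (B B' : {set vertex G}) : v0 \in B -> v0 \notin B' ->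
      \sum_(v in T :&: B) load d v = \sum_(v in T :&: B') load d v -> load d v0 = 0.
    move=> v0B v0B' S; move: S; rewrite (bigD1 v0) /=; last by rewrite finset.in_setI v0T.
    rewrite [X in _ + X]big1 ?addr0 => [->|v]; last first.
      by rewrite finset.in_setI => /andP[/andP[vT _]]; exact: loadT.
    apply: big1 => v; rewrite finset.in_setI => /andP[vT vB]; apply: loadT => //.
    by apply: contraNneq v0B' => <-.
  have [v0A|v0A] := boolP (v0 \in A).
    by apply: (only A (~: A)%SET) => //; [rewrite inE v0A|rewrite sA sC].
  by apply: (only (~: A)%SET A) => //; [rewrite inE|rewrite sA sC].
case: de; apply: extreme_kernel => // v vT.
by have [->|] := eqVneq v v0; [|exact: loadT].
Qed.

Lemma extreme_half_integral e : gamma e = (gamma e == 1)%:R + (e \in F)%:R / 2.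
Proof.
have [eF|eF] := boolP (e \in F).
  rewrite fractional_half //; case: eqP => [|_]; first by lra.
  by rewrite add0r mulr1n.
move: eF; rewrite inE negb_and !negbK => /orP[/eqP ->|/eqP ->].
  by rewrite eq_sym oner_eq0 mul0r addr0.
by rewrite eqxx mul0r addr0.
Qed.

(** * Edge covers from extreme points *)

(** Edges neither of value 1 nor in [F] have value 0 and cannot make up a load of 1. *)
Lemma uncovered_fractional v : (forall e, e \in delta v -> gamma e != 1) ->
  exists2 e, e \in delta v & e \in F.
Proof.
move=> v1; have [/exists_inP //|] := boolP [exists e in delta v, e \in F].
rewrite negb_exists_in => /forall_inP vF.
have := load_ge1 v; rewrite /load big1 ?ler10 // => e ev.
by apply/eqP; have := vF e ev; rewrite inE (v1 e ev) andbT negbK.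
Qed.

Lemma extreme_cover_bipartite : bipartite G ->
  exists2 C : {set edge G}, edge_cover C & indicator R C = gamma.
Proof.
move=> /bipartite_integral F0.
exists (finset (fun e => gamma e == 1)).
  move=> v; rewrite card_gt0; apply: contraT; rewrite negbK => /eqP C0.
  have [|e _] := uncovered_fractional v; last by rewrite F0 inE.
  move=> e ev; apply/negP => e1.
  by have := finset.in_set0 e; rewrite -C0 !inE e1; move: ev; rewrite inE => ->.
apply/funext => e; rewrite [RHS]extreme_half_integral F0 inE mul0r addr0.
by rewrite /indicator inE.
Qed.

(* Adjacent edges of [F] get different colours out of three, so removing any
   one colour class from [F] still covers [T]; the heaviest class has at least
   a third of the weight of [F]. *)
Lemma extreme_cover rho : (forall e, 0 <= rho e) ->
  exists2 C : {set edge G}, edge_cover C &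
    rho_length rho (indicator R C) <= 4 / 3 * rho_length rho gamma.
Proof.
move=> rho0; have [_ deg2 _] := fractional_2regular.
pose r : rel (edge G) := fun e f =>
  [&& e \in F, f \in F, e != f & [exists v, (e \in delta v) && (f \in delta v)]].
have rC : symmetric r.
  move=> e f; rewrite /r andbCA eq_sym; congr [&& _, _, _ & _].
  by apply: eq_existsb => v; rewrite andbC.
have rI : irreflexive r by move=> e; rewrite /r eqxx !andbF.
(* Each end of an edge of [F] lies in [T] and carries exactly one other edge of [F], so there is at
   most one neighbour per end. *)
have deg_r e : (#|finset (r e)| <= 2)%N.
  have [eF|eF] := boolP (e \in F); last first.
    by rewrite eq_card0 // => f; rewrite inE /r (negPf eF).
  have sub : (finset (r e) \subset \bigcup_(v in ends e) ((delta v :&: F) :\ e))%SET.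
    apply/fintype.subsetP => f; rewrite inE => /and4P[_ fF ef /existsP[v /andP[ev fv]]].
    apply/bigcupP; exists v; first by move: ev; rewrite inE.
    by rewrite 2!inE eq_sym ef inE fv.
  apply: leq_trans (subset_leq_card sub) _.
  have /andP[_] := card_ends e; apply: leq_trans.
  rewrite -[X in (_ <= X)%N]sum1_card.
  apply: (big_ind2 (fun (S : {set edge G}) n => #|S| <= n)%N) =>
    [|S1 n1 S2 n2 le1 le2|v ve].
  - by rewrite cards0.
  - by apply: leq_trans (leq_card_setU _ _).1 _; exact: leq_add.
  - have := deg2 v (fractional_ends _ _ eF ve).
    by rewrite (cardsD1 e) finset.in_setI in_delta ve eF add1n => -[->].
have [c cP] := greedy_coloring rC rI deg_r.
pose w i := \sum_(e in F | c e == i) rho e.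
have wE : \sum_(e in F) rho e = \sum_i w i by exact: partition_big.
have [i wi] : exists i, \sum_(e in F) rho e <= 3 * w i.
  apply/existsP; rewrite -[X in is_true X]negbK negb_exists; apply/negP => /forallP H.
  move: (H ord0) (H (lift ord0 ord0)) (H (lift ord0 (lift ord0 ord0))).
  rewrite wE 2!big_ord_recl big_ord1 -!ltNge; lra.
pose C := finset (fun e => (gamma e == 1) || (e \in F) && (c e != i)).
exists C.
  move=> v; rewrite card_gt0; apply: contraT; rewrite negbK => /eqP C0.
  have notC e : e \in delta v -> e \notin C.
    by move=> ev; apply/negP => eC; have := finset.in_set0 e; rewrite -C0 inE eC ev.
  (* An uncovered [v] would lie on two edges of [F], both of the removed colour [i] although they
     are adjacent. *)
  have [|e ev eF] := uncovered_fractional v.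
    by move=> e /notC; rewrite inE negb_or => /andP[].
  have vT : v \in T by apply: (fractional_ends e) => //; move: ev; rewrite inE.
  have [f] : exists f, f \in ((delta v :&: F) :\ e)%SET.
    by apply/card_gt0P; have := deg2 v vT; rewrite (cardsD1 e) finset.in_setI ev eF add1n => -[->].
  rewrite !finset.in_setD1 finset.in_setI => /and3P[fe fv fF].
  have col g : g \in delta v -> g \in F -> c g = i.
    move=> /notC gC gF; apply/eqP; move: gC; rewrite inE gF negb_or /=.
    by rewrite negbK => /andP[].
  have /cP : r e f.
    by rewrite /r eF fF eq_sym fe; apply/existsP; exists v; rewrite ev.
  by rewrite !col ?eqxx.
have -> : rho_length rho (indicator R C) =
    \sum_(e | gamma e == 1) rho e + (\sum_(e in F) rho e - w i).
  have -> : \sum_(e in F) rho e - w i = \sum_(e in F | c e != i) rho e.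
    by rewrite (bigID (fun e => c e == i)) /= addrAC subrr add0r.
  rewrite [X in X + _]big_mkcond [X in _ + X]big_mkcond -big_split.
  apply: eq_bigr => e _; rewrite /indicator finset.in_set.
  case: (gamma e =P 1) => [e1|_] /=.
    by rewrite [e \in F]finset.in_set e1 eqxx andbF mul1r addr0.
  by case: ifP; rewrite ?mul1r ?mul0r add0r.
have -> : rho_length rho gamma =
    \sum_(e | gamma e == 1) rho e + (\sum_(e in F) rho e) / 2.
  rewrite [X in X + _]big_mkcond [X in _ + X / _]big_mkcond mulr_suml -big_split.
  apply: eq_bigr => e _; rewrite [gamma e in LHS]extreme_half_integral /=.
  by case: (gamma e == 1); case: (e \in F); rewrite /= ?mulr1n ?mulr0n; lra.
(* With [S] the weight of [F], [S - w i <= 2 / 3 * S = 4 / 3 * (S / 2)]; nonnegativity lets the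
   edges of value 1 absorb the factor 4/3 as well. *)
have : 0 <= \sum_(e | gamma e == 1) rho e by apply: sumr_ge0.
lra.
Qed.

End ExtremePoint.

(** * Transfer of admissibility to fractional covers *)

(** Capping at 1 keeps [v] covered: either one edge at [v] reaches the cap and suffices alone, or no
    value at [v] changes. *)
Lemma truncate_cover gamma : fractional_edge_covers R G gamma ->
  forall i, 0 <= slack (fun e => Num.min (gamma e) 1) i.
Proof.
move=> [g0 g1] [[e|e]|v] /=.
- by rewrite le_min g0 ler01.
- by rewrite subr_ge0 ge_min lexx orbT.
have min0 e : 0 <= Num.min (gamma e) 1 by rewrite le_min g0 ler01.
rewrite subr_ge0 /load.
have [/exists_inP[e ev e1]|] := boolP [exists e in delta v, 1 <= gamma e].
  rewrite (bigD1 e) //= (min_r e1) lerDl.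
  by apply: sumr_ge0 => f _; exact: min0.
rewrite negb_exists_in => /forall_inP vlt; apply: le_trans (g1 v) _.
apply: ler_sum => e ev; rewrite min_l //; apply: ltW.
by rewrite ltNge; exact: vlt.
Qed.

Lemma extreme_below rho gamma : (forall e, 0 <= rho e) ->
  fractional_edge_covers R G gamma ->
  exists gamma', [/\ forall i, 0 <= slack gamma' i, extreme gamma' &
    rho_length rho gamma' <= rho_length rho gamma].
Proof.
move=> rho0 /truncate_cover /(extreme_reduction rho)[g [g1 g2 g3]].
exists g; split=> //; apply: le_trans g3 _.
by apply: ler_sum => e _; apply: ler_wpM2r => //; rewrite ge_min lexx.
Qed.

Lemma Adm_edge_covers_scale rho : Adm (edge_covers R G) rho ->
  Adm (fractional_edge_covers R G) (fun e => 4 / 3 * rho e).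
Proof.
move=> [rho0 rho1]; split=> [e|gamma fec]; first by rewrite mulr_ge0 //; lra.
have [g [g1 g2 g3]] := extreme_below _ _ rho0 fec.
have [C covC leC] := extreme_cover g g1 g2 rho rho0.
have := rho1 _ (ex_intro2 _ _ C covC erefl).
have -> : rho_length (fun e => 4 / 3 * rho e) gamma = 4 / 3 * rho_length rho gamma.
  by rewrite /rho_length mulr_sumr; apply: eq_bigr => e _; rewrite mulrCA.
lra.
Qed.

Lemma Adm_edge_covers_bipartite rho : bipartite G -> Adm (edge_covers R G) rho ->
  Adm (fractional_edge_covers R G) rho.
Proof.
move=> bip [rho0 rho1]; split=> // gamma fec.
have [g [g1 g2 g3]] := extreme_below _ _ rho0 fec.
have [C covC EC] := extreme_cover_bipartite g g1 g2 bip.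
by apply: le_trans g3; apply: rho1; exists C.
Qed.

Lemma edge_covers_fractional gamma :
  edge_covers R G gamma -> fractional_edge_covers R G gamma.
Proof.
move=> [C covC ->]; split=> [e|v]; first by rewrite /indicator ler0n.
rewrite /indicator -natr_sum ler1n; apply: leq_trans (covC v) _.
rewrite -sum1_card big_mkcond [X in (_ <= X)%N]big_mkcond /=.
by apply: leq_sum => e _; rewrite finset.in_setI; case: (e \in C); case: (e \in delta v).
Qed.

End EdgeCoverPolytope.

(** * Comparison of the moduli *)

Lemma le_Mod {R : realType} {E : finType} (p : R) (sigma : E -> R)
    (Gamma Gamma' : set (E -> R)) :
  (forall rho, Adm Gamma' rho -> Adm Gamma rho) ->
  (Mod p sigma Gamma <= Mod p sigma Gamma')%E.
Proof.
by move=> sub; apply: ereal_inf_le_tmp => _ [rho /sub rhoA <-]; exists rho.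
Qed.

Lemma energy_scale {R : realType} {E : finType} (p c : R) (sigma rho : E -> R) :
  0 <= c -> (forall e, 0 <= rho e) ->
  energy p sigma (fun e => c * rho e) = c `^ p * energy p sigma rho.
Proof.
move=> c0 rho0; rewrite /energy mulr_sumr; apply: eq_bigr => e _.
by rewrite powRM // mulrCA.
Qed.

Theorem theorem2 (R : realType) (G : ugraph) (sigma : edge G -> R)
    (sigma_gt0 : forall e : edge G, 0 < sigma e) :
  (forall p : R, 1 <= p ->
     (((3 / 4) `^ p)%:E * Mod p sigma (fractional_edge_covers R G)
        <= Mod p sigma (edge_covers R G))%E /\
     (Mod p sigma (edge_covers R G)
        <= Mod p sigma (fractional_edge_covers R G))%E) /\
  (bipartite G -> forall p : R, 1 <= p ->
     Mod p sigma (edge_covers R G) = Mod p sigma (fractional_edge_covers R G)).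
Proof.
have le_ec p : (Mod p sigma (edge_covers R G)
    <= Mod p sigma (fractional_edge_covers R G))%E.
  apply: le_Mod => rho [rho0 rho1]; split=> // gamma.
  by move=> /edge_covers_fractional; exact: rho1.
split=> [p _|bip p _].
  split=> //; apply: le_ereal_inf_tmp => _ [rho rhoA <-].
  (* The density [4 / 3 * rho] competes for the fractional modulus; its energy gains the [p]-th
     power of 4/3, which cancels that of 3/4. *)
  have := Adm_edge_covers_scale _ _ _ rhoA; set rho' := (X in Adm _ X) => rhoA'.
  have : (Mod p sigma (fractional_edge_covers R G) <= (energy p sigma rho')%:E)%E.
    by apply: ereal_inf_lbound; exists rho'.
  have c0 : (0 <= ((3 / 4) `^ p)%:E :> \bar R)%E by rewrite lee_fin powR_ge0.
  move=> /(lee_wpmul2l c0) /le_trans; apply; rewrite -EFinM lee_fin.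
  rewrite energy_scale; [|lra|exact: rhoA.1].
  rewrite mulrA -powRM; [|lra|lra].
  by rewrite (_ : 3 / 4 * (4 / 3) = 1) ?powR1 ?mul1r //; lra.
(* In the bipartite case admissibility transfers without the factor 4/3, which gives the reverse
   inequality. *)
apply/le_anti; rewrite le_ec /=; apply: le_Mod => rho.
exact: Adm_edge_covers_bipartite.
Qed.
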